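(* Suppose that at time step $k$ (the previous measurement instant) the actual state satisfies $(C_k,\omega_k)\in\mathcal{E}(\hat C_k,\hat\omega_k,P_k)$, and that at time step $k+l$ (the current measurement instant) the measurement errors satisfy $\nu^i\in\mathcal{E}_{\mathbb{R}^3}(0,S^i)$ for $i=1,\dots,m$ and $\upsilon\in\mathcal{E}_{\mathbb{R}^3}(0,T)$. Let $(\hat C^f,\hat\omega^f,P^f)$ and $(\hat C^m,\hat\omega^m,P^m)$ be the flow-predicted and measured centers and uncertainty matrices at step $k+l$, as defined in the context. Let $\hat\zeta^{mf},\delta\hat\omega^{mf}\in\mathbb{R}^3$ be defined by $\hat C^f=\hat C^m\exp(S(\hat\zeta^{mf}))$ and $\hat\omega^f=\hat\omega^m+\delta\hat\omega^{mf}$, and put $\hat x^{mf}=[(\hat\zeta^{mf})^{T},(\delta\hat\omega^{mf})^{T}]^{T}\in\mathbb{R}^6$. For $q>0$ let $$L=P^m(P^m+q^{-1}P^f)^{-1},\quad \beta(q)=1+q-(\hat x^{mf})^{T}(P^m)^{-1}L\,\hat x^{mf},\quad \hat x=L\hat x^{mf},\quad P=\beta(q)(I-L)P^m,$$ where $q$ is chosen so that $\mathrm{tr}[P]$ is minimized, and write $\hat x=[\hat\zeta^{T},\delta\hat\omega^{T}]^{T}$ with $\hat\zeta,\delta\hat\omega\in\mathbb{R}^3$. The attitude and angular velocity estimates and the new uncertainty matrix at step $k+l$ are given by $$\hat C_{k+l}=\hat C^m\exp(S(\hat\zeta)),\qquad \hat\omega_{k+l}=\hat\omega^m+\delta\hat\omega,\qquad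 P_{k+l}=P .$$ Then (within the first-order approximations stated in the context) the actual state lies in the ellipsoid centered at the estimated attitude and angular velocity: $$(C_{k+l},\omega_{k+l})\in\mathcal{E}(\hat C_{k+l},\hat\omega_{k+l},P_{k+l}).$$
   Context: **Notation.** $S:\mathbb{R}^3\to\mathfrak{so}(3)$ is defined by $S(x)y=x\times y$. For $\hat x\in\mathbb{R}^n$ and $P\in\mathbb{R}^{n\times n}$ symmetric positive definite, $\mathcal{E}_{\mathbb{R}^n}(\hat x,P)=\{x\in\mathbb{R}^n: (x-\hat x)^{T}P^{-1}(x-\hat x)\le 1\}$; $P$ is called the uncertainty matrix. For $\hat C\in SO(3)$, $\hat\omega\in\mathbb{R}^3$ and $P\in\mathbb{R}^{6\times6}$ symmetric positive definite, $\mathcal{E}(\hat C,\hat\omega,P)$ is the set of $(C,\omega)\in SO(3)\times\mathbb{R}^3$ with $C=\hat C\exp(S(\zeta))$, $\omega=\hat\omega+\delta\omega$ for some $x=[\zeta^{T},\delta\omega^{T}]^{T}\in\mathcal{E}_{\mathbb{R}^6}(0,P)$; here $S(\zeta)=\mathrm{logm}(\hat C^{T}C)$. All uncertainty matrices (in particular $P_k,P^f,P^m,P$) are symmetric positive definite. **Dynamics.** $J\in\mathbb{R}^{3\times3}$ is the moment of inertia matrix, $J_d=\frac12\mathrm{tr}[J]I_{3\times3}-J$, $h>0$ is the step size, $U:SO(3)\to\mathbb{R}$ is the potential, and the moment $M=M(C)\in\mathbb{R}^3$ is defined by $S(M)=\left(\frac{\partial U}{\partial C}\right)^{T}C-C^{T}\frac{\partial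 U}{\partial C}$. The discrete flow $(C_k,\omega_k)\mapsto(C_{k+1},\omega_{k+1})$ is given by $hS(J\omega_k+\frac h2M_k)=F_kJ_d-J_dF_k^{T}$ (solved for $F_k=\exp(S(f_k))\in SO(3)$), $C_{k+1}=C_kF_k$, $J\omega_{k+1}=F_k^{T}J\omega_k+\frac h2F_k^{T}M_k+\frac h2M_{k+1}$, with $M_k=M(C_k)$. The actual state evolves by this flow. **Flow update.** $(\hat C^f,\hat\omega^f)$ is the image of $(\hat C_k,\hat\omega_k)$ under $l$ steps of the discrete flow. $A^f_j\in\mathbb{R}^{6\times6}$ is the matrix of the linearization of one step of the discrete flow along this predicted trajectory at step $j$, in the coordinates $x=[\zeta^{T},\delta\omega^{T}]^{T}$ in which a perturbed state is $(\hat C\exp(S(\zeta)),\hat\omega+\delta\omega)$. Set $A^f=A^f_{k+l-1}\cdots A^f_k$ and $P^f=A^fP_k(A^f)^{T}$. **Measurements.** There are $m\ge3$ known inertial unit vectors $e^1,\dots,e^m$, no two collinear; the corresponding body-frame unit vectors at step $k+l$ are $b^i$, with $e^i=C_{k+l}b^i$. Unit vectors $\tilde b^i$ are measured, with $b^i=\exp(S(\nu^i))\tilde b^i\simeq\tilde b^i+S(\nu^i)\tilde b^i$. The angular velocity measurement is $\tilde\omega$, with $\omega_{k+l}=\tilde\omega+\upsilon$. $S^i,T\in\mathbb{R}^{3\times3}$ are symmetric positive definite. $E=[e^1,\dots,e^m]$, $\tilde B=[\tilde b^1,\dots,\tilde b^m]$, $W=\mathrm{diag}[w_1,\dots,w_m]$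 is the matrix of weights, and $\tilde L=EW\tilde B^{T}$ is assumed invertible. **Measurement update.** $\hat C^m=Q_q\sqrt{(Q_rQ_r^{T})^{-1}}\,Q_q^{T}\tilde L$, where $\tilde L=Q_qQ_r$ with $Q_q\in SO(3)$ and $Q_r$ upper triangular and invertible, and the square root is the symmetric positive definite one. $\hat\omega^m=\tilde\omega$. For $i=1,\dots,m$, $$\mathcal{A}^{i}=-\{\mathrm{tr}[(\hat C^m)^{T}\tilde L]I_{3\times3}-(\hat C^m)^{T}\tilde L\}^{-1}w_i\{\mathrm{tr}[\tilde b^i(e^i)^{T}\hat C^m]I_{3\times3}-\tilde b^i(e^i)^{T}\hat C^m\}.$$ With $H_1=[I_{3\times3},0_{3\times3}]^{T}$, $H_2=[0_{3\times3},I_{3\times3}]^{T}$, $N_i=H_1\mathcal{A}^iS^i(\mathcal{A}^i)^{T}H_1^{T}$ for $1\le i\le m$ and $N_{m+1}=H_2TH_2^{T}$, $$P^m=\Big\{\sum_{i=1}^{m+1}\sqrt{\mathrm{tr}[N_i]}\Big\}\Big\{\sum_{i=1}^{m+1}\frac{N_i}{\sqrt{\mathrm{tr}[N_i]}}\Big\}.$$ **Standing first-order approximations.** The uncertainties and errors are assumed small enough that the following first-order relations are taken as exact. Write $C_k=\hat C_k\exp(S(\zeta_k))$, $\omega_k=\hat\omega_k+\delta\omega_k$ with $x_k=[\zeta_k^{T},\delta\omega_k^{T}]^{T}$; $C_{k+l}=\hat C^f\exp(S(\zeta^f))=\hat C^m\exp(S(\zeta^m))=\hat C_{k+l}\exp(S(\zeta))$;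 $\delta\omega^f=\omega_{k+l}-\hat\omega^f$, $\delta\omega^m=\omega_{k+l}-\hat\omega^m$. Then: (i) $[(\zeta^f)^{T},(\delta\omega^f)^{T}]^{T}=A^fx_k$; (ii) $\zeta^m=\sum_{i=1}^m\mathcal{A}^i\nu^i$ (and $\delta\omega^m=\upsilon$); (iii) products of exponentials of small skew matrices are exponentials of sums, so that $\zeta^m=\hat\zeta^{mf}+\zeta^f$ and $\zeta^m=\hat\zeta+\zeta$. *)

(* Defs.v *)
From mathcomp Require Import all_boot all_order all_algebra.
From mathcomp Require Import complex.
From mathcomp Require Import all_classical all_reals all_analysis.
Set Implicit Arguments.
Unset Strict Implicit.
Unset Printing Implicit Defensive.
Import Order.TTheory GRing.Theory Num.Theory.
Import numFieldNormedType.Exports.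
Local Open Scope classical_set_scope.
Local Open Scope ring_scope.

Definition dotv (R : realType) n (u v : 'cV[R]_n) : R := (u^T *m v) 0 0.

Definition unit_vector (R : realType) n (u : 'cV[R]_n) : Prop := dotv u u = 1.

Definition spd (R : realType) n (A : 'M[R]_n) : Prop :=
  A^T = A /\ forall x : 'cV[R]_n, x != 0 -> 0 < dotv x (A *m x).

(* Indices are added in the cyclic group 'I_3. *)
Definition cross (R : realType) (u v : 'cV[R]_3) : 'cV[R]_3 :=
  \col_i (u (i + 1) 0 * v (i + 2%:R) 0 - u (i + 2%:R) 0 * v (i + 1) 0).

(* The matrix of y |-> x * y (cross product); see [SmxE]. *)
Definition Smx (R : realType) (x : 'cV[R]_3) : 'M[R]_3 :=
  \matrix_(i, j) cross x (delta_mx j 0) i 0.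

(* Inverse of [Smx] on antisymmetric matrices; see [veeK]. *)
Definition vee (R : realType) (X : 'M[R]_3) : 'cV[R]_3 :=
  \col_i X (i + 2%:R) (i + 1).

Definition SO3 (R : realType) : set 'M[R]_3 :=
  [set C | C^T *m C = 1%:M /\ \det C = 1].

Definition expm (R : realType) n (A : 'M[R]_n.+1) : 'M[R]_n.+1 :=
  limn (series (fun k : nat => (k`!%:R)^-1 *: A ^+ k)).

(* The principal logarithm: the logarithm whose complex eigenvalues all lie in
   the open strip -pi < Im z < pi.  [logm] is 0 on matrices that have none. *)
Definition principal_log (R : realType) n (A X : 'M[R]_n.+1) : Prop :=
  expm X = A /\
  forall z : R[i], eigenvalue (map_mx (real_complex R) X) z ->
    `|complex.Im z| < pi.

Definition logm (R : realType) n (A : 'M[R]_n.+1) : 'M[R]_n.+1 :=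
  xget 0 [set X | principal_log A X].

Definition sqrtm (R : realType) n (A : 'M[R]_n) : 'M[R]_n :=
  xget 0 [set X | spd X /\ X *m X = A].

Definition ellipsoid (R : realType) n (xh : 'cV[R]_n) (P : 'M[R]_n) :
    set 'cV[R]_n :=
  [set x | dotv (x - xh) (invmx P *m (x - xh)) <= 1].

Definition state (R : realType) : Type := ('M[R]_3 * 'cV[R]_3)%type.

Definition att_part (R : realType) (x : 'cV[R]_6) : 'cV[R]_3 :=
  usubmx (x : 'cV[R]_(3 + 3)).

Definition vel_part (R : realType) (x : 'cV[R]_6) : 'cV[R]_3 :=
  dsubmx (x : 'cV[R]_(3 + 3)).

Definition perturb (R : realType) (s : state R) (x : 'cV[R]_6) : state R :=
  (s.1 *m expm (Smx (att_part x)), s.2 + vel_part x).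

(* x = [zeta; domega] is the error of s relative to sh, where
   Smx zeta = logm (Ch^T C) removes the ambiguity of zeta in
   C = Ch exp(Smx zeta). *)
Definition error_coord (R : realType) (sh s : state R) (x : 'cV[R]_6) : Prop :=
  s = perturb sh x /\ Smx (att_part x) = logm (sh.1^T *m s.1).

Definition state_ellipsoid (R : realType) (sh : state R) (P : 'M[R]_6) :
    set (state R) :=
  [set s | SO3 s.1 /\ exists2 x, ellipsoid 0 P x & error_coord sh s x].

(* U extends the potential from SO(3) to all 3 x 3 matrices, so that its entrywise
   partial derivatives make sense; on SO(3) the moment does not depend on the
   choice of a differentiable extension. *)
Definition gradU (R : realType) (U : 'M[R]_3 -> R) (C : 'M[R]_3) : 'M[R]_3 :=
  \matrix_(i, j) 'D_(delta_mx i j) U C.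

Definition moment (R : realType) (U : 'M[R]_3 -> R) (C : 'M[R]_3) : 'cV[R]_3 :=
  vee ((gradU U C)^T *m C - C^T *m gradU U C).

Definition Jd (R : realType) (J : 'M[R]_3) : 'M[R]_3 :=
  (\tr J / 2%:R)%:M - J.

(* The flow is implicit, hence given as a relation: s' is an image of s for some
   solution F of the implicit equation. *)
Definition flow_step (R : realType) (J : 'M[R]_3) (h : R) (U : 'M[R]_3 -> R)
    (s s' : state R) : Prop :=
  exists F : 'M[R]_3,
    [/\ SO3 F /\ (exists f : 'cV[R]_3, F = expm (Smx f)),
        h *: Smx (J *m s.2 + (h / 2%:R) *: moment U s.1)
          = F *m Jd J - Jd J *m F^T,
        s'.1 = s.1 *m F &
        J *m s'.2 = F^T *m J *m s.2 + (h / 2%:R) *: (F^T *m moment U s.1)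
                    + (h / 2%:R) *: moment U s'.1].

(* A is the derivative at 0 of a local expression phi of the flow map near s,
   in the error coordinates of [perturb] around s and around its image s'. *)
Definition flow_linearization (R : realType) (J : 'M[R]_3) (h : R)
    (U : 'M[R]_3 -> R) (s s' : state R) (A : 'M[R]_6) : Prop :=
  exists phi : 'cV[R]_6 -> 'cV[R]_6,
    [/\ phi 0 = 0,
        \forall x \near (0 : 'cV[R]_6),
          flow_step J h U (perturb s x) (perturb s' (phi x)) &
        is_diff (0 : 'cV[R]_6) phi (fun x => A *m x)].

(* A (k + l - 1) *m ... *m A k *)
Definition flow_matrix (R : realType) (A : nat -> 'M[R]_6) (k l : nat) :
    'M[R]_6 :=
  \big[mulmx/1%:M]_(j <- rev (iota k l)) A j.

Definition Lmat (R : realType) m (e bt : 'I_m -> 'cV[R]_3) (w : 'I_m -> R) :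
    'M[R]_3 :=
  (\matrix_(i, j) e j i 0) *m diag_mx (\row_j w j)
    *m (\matrix_(i, j) bt j i 0)^T.

Definition meas_attitude (R : realType) (Qq Qr Lt : 'M[R]_3) : 'M[R]_3 :=
  Qq *m sqrtm (invmx (Qr *m Qr^T)) *m Qq^T *m Lt.

Definition meas_gain (R : realType) m (e bt : 'I_m -> 'cV[R]_3)
    (w : 'I_m -> R) (Lt Cm : 'M[R]_3) (i : 'I_m) : 'M[R]_3 :=
  - (invmx ((\tr (Cm^T *m Lt))%:M - Cm^T *m Lt)
     *m (w i *: ((\tr (bt i *m (e i)^T *m Cm))%:M - bt i *m (e i)^T *m Cm))).

Definition H1 (R : realType) : 'M[R]_(6, 3) :=
  (col_mx 1%:M 0 : 'M[R]_(3 + 3, 3)).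

Definition H2 (R : realType) : 'M[R]_(6, 3) :=
  (col_mx 0 1%:M : 'M[R]_(3 + 3, 3)).

(* 'I_m.+1 lists the m direction terms followed, at [ord_max], by the angular
   velocity term. *)
Definition meas_terms (R : realType) m (A Sg : 'I_m -> 'M[R]_3) (T : 'M[R]_3)
    (i : 'I_m.+1) : 'M[R]_6 :=
  if unlift ord_max i is Some j
  then H1 R *m A j *m Sg j *m (A j)^T *m (H1 R)^T
  else H2 R *m T *m (H2 R)^T.

Definition meas_uncertainty (R : realType) m (A Sg : 'I_m -> 'M[R]_3)
    (T : 'M[R]_3) : 'M[R]_6 :=
  let N := meas_terms A Sg T in
  (\sum_i Num.sqrt (\tr (N i))) *: (\sum_i (Num.sqrt (\tr (N i)))^-1 *: N i).

Definition fuse_gain (R : realType) (Pm Pf : 'M[R]_6) (q : R) : 'M[R]_6 :=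
  Pm *m invmx (Pm + q^-1 *: Pf).

Definition fuse_beta (R : realType) (Pm Pf : 'M[R]_6) (xmf : 'cV[R]_6) (q : R) :
    R :=
  1 + q - dotv xmf (invmx Pm *m fuse_gain Pm Pf q *m xmf).

Definition fuse_uncertainty (R : realType) (Pm Pf : 'M[R]_6) (xmf : 'cV[R]_6)
    (q : R) : 'M[R]_6 :=
  fuse_beta Pm Pf xmf q *: ((1%:M - fuse_gain Pm Pf q) *m Pm).

Lemma SmxE (R : realType) (x y : 'cV[R]_3) : Smx x *m y = cross x y.
Proof.
apply/matrixP => i j; rewrite (ord1 j) !mxE.
rewrite (eq_bigr (fun k => (x (i + 1) 0 * (i + 2%:R == k)%:R
    - x (i + 2%:R) 0 * (i + 1 == k)%:R) * y k 0)); last first.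
  by move=> k _; rewrite !mxE !eqxx !andbT.
under eq_bigr => k _ do rewrite mulrBl.
rewrite sumrB (bigD1 (i + 2%:R)) //= [X in _ - X](bigD1 (i + 1)) //=.
rewrite !eqxx !mulr1 big1 ?addr0; last first.
  by move=> k /negbTE; rewrite eq_sym => ->; rewrite mulr0 mul0r.
rewrite big1 ?addr0 //.
by move=> k /negbTE; rewrite eq_sym => ->; rewrite mulr0 mul0r.
Qed.

Lemma veeK (R : realType) (X : 'M[R]_3) : X^T = - X -> Smx (vee X) = X.
Proof.
move=> /matrixP XN.
have XE i j : X j i = - X i j by have := XN i j; rewrite !mxE.
have X0 i : X i i = 0.
  by apply/eqP; rewrite -[_ == 0](mulrn_eq0 (X i i) 2) mulr2n {1}XE addNr.
apply/matrixP => i j; rewrite !mxE !eqxx !andbT.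
have -> : i + 1 + 2%:R = i by apply/val_inj; case: i => [[|[|[|]]]].
have -> : i + 2%:R + 1 = i by apply/val_inj; case: i => [[|[|[|]]]].
have -> : i + 1 + 1 = i + 2%:R by rewrite -addrA.
have -> : i + 2%:R + 2%:R = i + 1 by apply/val_inj; case: i => [[|[|[|]]]].
have [->|->|->] : [\/ j = i, j = i + 1 | j = i + 2%:R].
- by case: i j => [[|[|[|]]] ?] // [[|[|[|]]] ?] //;
    [constructor 1|constructor 2|constructor 3|constructor 3|constructor 1
    |constructor 2|constructor 2|constructor 3|constructor 1]; apply/val_inj.
- have -> : (i + 2%:R == i) = false by case: i => [[|[|[|]]]].
  have -> : (i + 1 == i) = false by case: i => [[|[|[|]]]].
  by rewrite !mulr0 subr0 X0.
- have -> : (i + 2%:R == i + 1) = false by case: i => [[|[|[|]]]].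
  by rewrite eqxx mulr0 mulr1 sub0r -XE.
- have -> : (i + 1 == i + 2%:R) = false by case: i => [[|[|[|]]]].
  by rewrite eqxx mulr0 mulr1 subr0.
Qed.

Lemma Smx_moment (R : realType) (U : 'M[R]_3 -> R) (C : 'M[R]_3) :
  Smx (moment U C) = (gradU U C)^T *m C - C^T *m gradU U C.
Proof.
by apply: veeK; rewrite linearB /= !trmx_mul !trmxK opprB.
Qed.

(* Main.v *)
(* Writing [dotv y (P *m y)] as the squared support function of E(0, P), the
   point x lies in E(0, P) iff [dotv y x ^+ 2 <= dotv y (P *m y)] for all y.  In
   this form linear images of ellipsoids and the trace-weighted outer bound of a
   Minkowski sum are immediate (Cauchy-Schwarz), even though the terms N_i are
   singular.  So the error x^m relative to the measured center lies in E(0, P^m)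
   and x^m - x^mf in E(0, P^f); adding the first inequality to q times the
   second and completing the square in x^m gives the fused ellipsoid. *)
Require Import Defs.
From mathcomp Require Import all_boot all_order all_algebra.
From mathcomp Require Import all_classical all_reals all_analysis.
From mathcomp Require Import ring lra.
Set Implicit Arguments.
Unset Strict Implicit.
Unset Printing Implicit Defensive.
Import Order.TTheory GRing.Theory Num.Theory.
Import numFieldNormedType.Exports.
Local Open Scope classical_set_scope.
Local Open Scope ring_scope.

(** * Bilinearity and symmetry of the dot product *)

Section Dot.
Context {R : realType}.
Implicit Types n : nat.

Lemma dotvC n (u v : 'cV[R]_n) : dotv u v = dotv v u.
Proof. by rewrite /dotv -[v^T *m u]trmxK trmx_mul trmxK [RHS]mxE. Qed.

Lemma dotvDl n (u1 u2 v : 'cV[R]_n) : dotv (u1 + u2) v = dotv u1 v + dotv u2 v.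
Proof. by rewrite /dotv linearD mulmxDl mxE. Qed.

Lemma dotvDr n (u v1 v2 : 'cV[R]_n) : dotv u (v1 + v2) = dotv u v1 + dotv u v2.
Proof. by rewrite dotvC dotvDl !(dotvC u). Qed.

Lemma dotvZl n a (u v : 'cV[R]_n) : dotv (a *: u) v = a * dotv u v.
Proof. by rewrite /dotv linearZ -scalemxAl mxE. Qed.

Lemma dotvZr n a (u v : 'cV[R]_n) : dotv u (a *: v) = a * dotv u v.
Proof. by rewrite dotvC dotvZl dotvC. Qed.

Lemma dotvNl n (u v : 'cV[R]_n) : dotv (- u) v = - dotv u v.
Proof. by rewrite -scaleN1r dotvZl mulN1r. Qed.

Lemma dotvNr n (u v : 'cV[R]_n) : dotv u (- v) = - dotv u v.
Proof. by rewrite dotvC dotvNl dotvC. Qed.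

Lemma dotv0l n (v : 'cV[R]_n) : dotv 0 v = 0.
Proof. by rewrite /dotv trmx0 mul0mx mxE. Qed.

Lemma dotv_sumr n (I : finType) (u : 'cV[R]_n) (F : I -> 'cV[R]_n) :
  dotv u (\sum_i F i) = \sum_i dotv u (F i).
Proof. by rewrite /dotv mulmx_sumr summxE. Qed.

Lemma dotv_mulmx n p (A : 'M[R]_(n, p)) (u : 'cV[R]_n) (v : 'cV[R]_p) :
  dotv u (A *m v) = dotv (A^T *m u) v.
Proof. by rewrite /dotv trmx_mul trmxK mulmxA. Qed.

End Dot.

(** * Positive definite matrices and support functions of ellipsoids *)

Section PosDef.
Context {R : realType}.
Implicit Types n : nat.

Lemma spd_ge0 n (A : 'M[R]_n) x : spd A -> 0 <= dotv x (A *m x).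
Proof.
move=> [_ A0]; have [->|/A0 /ltW //] := eqVneq x 0.
by rewrite dotv0l.
Qed.

Lemma spd_eq0 n (A : 'M[R]_n) x : spd A -> dotv x (A *m x) = 0 -> x = 0.
Proof.
move=> [_ A0] xAx; apply/eqP; apply: contraT => /A0.
by rewrite xAx ltxx.
Qed.

(** A row [u] of the left kernel satisfies [u *m A *m u^T = 0], so it vanishes by definiteness. *)
Lemma spd_unitmx n (A : 'M[R]_n) : spd A -> A \in unitmx.
Proof.
move=> hA; rewrite -row_free_unit -kermx_eq0; apply/eqP/row_matrixP => i.
rewrite row0; apply: trmx_inj; rewrite trmx0; apply: (spd_eq0 hA).
have : row i (kermx A) *m A = 0 by apply/sub_kermxP; exact: row_sub.
by rewrite /dotv trmxK mulmxA => ->; rewrite mul0mx mxE.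
Qed.

Lemma spd_invmx n (A : 'M[R]_n) : spd A -> spd (invmx A).
Proof.
move=> hA; have uA := spd_unitmx hA; have [sA A0] := hA.
split=> [|x x0]; first by rewrite trmx_inv sA.
rewrite -{1}(mulKVmx uA x) dotvC; apply: A0.
by apply: contra_neq x0 => x0; rewrite -(mulKVmx uA x) x0 mulmx0.
Qed.

Lemma spd_dotvC n (A : 'M[R]_n) x y : spd A -> dotv x (A *m y) = dotv y (A *m x).
Proof. by move=> [sA _]; rewrite dotv_mulmx sA dotvC. Qed.

Lemma ellipsoid_support n (P : 'M[R]_n) (x y : 'cV[R]_n) :
  spd P -> ellipsoid 0 P x -> dotv y x ^+ 2 <= dotv y (P *m y).
Proof.
move=> hP; rewrite /ellipsoid /= subr0 => x1.
have uP := spd_unitmx hP; have hV := spd_invmx hP.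
have [->|y0] := eqVneq y 0; first by rewrite !dotv0l expr0n.
have g0 := hP.2 _ y0; set g := dotv y _ in g0 *; set a := dotv y x.
(* The multiple [a / g] of [P *m y] is the one closest to [x] in the norm of [invmx P];
   nonnegativity of the squared distance is Cauchy-Schwarz. *)
have := spd_ge0 (x - (a / g) *: (P *m y)) hV.
rewrite mulmxDr mulmxN -scalemxAr mulKmx // dotvDl !dotvDr !dotvNl !dotvNr.
rewrite !dotvZl !dotvZr [dotv (P *m y) (_ *m x)]spd_dotvC // mulKmx //.
rewrite [dotv (P *m y) y]dotvC -/g [dotv x y]dotvC -/a => p.
have : a / g * a <= 1.
  have e : a / g * (a / g * g) = a / g * a by rewrite mulfVK // gt_eqF.
  by rewrite -e in p *; lra.
by rewrite mulrAC ler_pdivrMr // mul1r expr2.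
Qed.

Lemma support_ellipsoid n (P : 'M[R]_n) (x : 'cV[R]_n) :
  spd P -> (forall y, dotv y x ^+ 2 <= dotv y (P *m y)) -> ellipsoid 0 P x.
Proof.
move=> hP hx; rewrite /ellipsoid /= subr0.
have uP := spd_unitmx hP.
(* In this direction both sides involve only [t = dotv x (invmx P *m x)], and [t ^+ 2 <= t] forces
   [t <= 1]. *)
have := hx (invmx P *m x); rewrite mulKVmx // dotvC => p.
have [//|lt1] := leP; nra.
Qed.

Lemma ellipsoid_mulmx n p (B : 'M[R]_(p, n)) (P : 'M[R]_n) (x : 'cV[R]_n) :
  spd P -> spd (B *m P *m B^T) -> ellipsoid 0 P x ->
  ellipsoid 0 (B *m P *m B^T) (B *m x).
Proof.
move=> hP hBP hx; apply: support_ellipsoid => // y.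
by rewrite -!mulmxA !(dotv_mulmx B) ellipsoid_support.
Qed.

End PosDef.

(** * Trace-weighted outer ellipsoid of a Minkowski sum *)

Section MinkowskiSum.
Context {R : realType}.

(** Cauchy-Schwarz with weights [p i] that may vanish: where [p i = 0], also [g i = 0] and hence
    [a i = 0], so the term drops out on both sides. *)
Lemma sqr_sum_le_weighted (I : finType) (p a g : I -> R) :
  (forall i, 0 <= p i) -> (forall i, a i ^+ 2 <= g i) ->
  (forall i, p i = 0 -> g i = 0) ->
  (\sum_i a i) ^+ 2 <= (\sum_i p i) * \sum_i (p i)^-1 * g i.
Proof.
move=> p0 ag pg0; set s := \sum_i p i; set A := \sum_i a i.
have a0 i : p i = 0 -> a i = 0.
  move=> /pg0 gi; apply/eqP; rewrite -[_ == _](expf_eq0 (a i) 2).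
  by rewrite eq_le sqr_ge0 andbT -gi ag.
have s0 : 0 <= s by apply: sumr_ge0.
have [sE|sN0] := eqVneq s 0.
  have -> : A = 0.
    by apply: big1 => i _; apply: a0; apply: (psumr_eq0P (fun j _ => p0 j) sE).
  by rewrite sE mul0r expr0n.
have sp : 0 < s by rewrite lt_neqAle eq_sym sN0.
(* This [t] maximizes [2 * t * A - t ^+ 2 * s], with value [A ^+ 2 / s]; each summand is bounded
   separately by [(a i - t * p i) ^+ 2 >= 0]. *)
set t := A / s.
have : \sum_i (2 * t * a i - t ^+ 2 * p i) <= \sum_i (p i)^-1 * g i.
  apply: ler_sum => i _; have [pi0|piN0] := eqVneq (p i) 0.
    by rewrite a0 // pg0 // pi0 !mulr0 subr0.
  have pp : 0 < p i by rewrite lt_neqAle eq_sym piN0 p0.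
  rewrite [leRHS]mulrC ler_pdivlMr //; apply: le_trans (ag i).
  rewrite -subr_ge0.
  have -> : a i ^+ 2 - (2 * t * a i - t ^+ 2 * p i) * p i
    = (a i - t * p i) ^+ 2 by ring.
  exact: sqr_ge0.
rewrite sumrB -!mulr_sumr -/A -/s.
have -> : 2 * t * A - t ^+ 2 * s = A ^+ 2 / s by rewrite /t; field.
by rewrite ler_pdivrMr // mulrC.
Qed.

Lemma mxtrace_congr n d (B : 'M[R]_(n, d)) (Q : 'M[R]_d) :
  \tr (B *m Q *m B^T) = \sum_i dotv (row i B)^T (Q *m (row i B)^T).
Proof.
apply: eq_bigr => i _.
rewrite /dotv trmxK mulmxA -row_mul mxE [RHS]mxE.
by apply: eq_bigr => j _; rewrite !mxE.
Qed.

Lemma mxtrace_congr_ge0 n d (B : 'M[R]_(n, d)) (Q : 'M[R]_d) :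
  spd Q -> 0 <= \tr (B *m Q *m B^T).
Proof. by move=> hQ; rewrite mxtrace_congr sumr_ge0 // => i _; apply: spd_ge0. Qed.

(** The trace is the sum of the squared [Q]-norms of the rows of [B], so each row must vanish. *)
Lemma mxtrace_congr_eq0 n d (B : 'M[R]_(n, d)) (Q : 'M[R]_d) :
  spd Q -> \tr (B *m Q *m B^T) = 0 -> B = 0.
Proof.
move=> hQ /eqP; rewrite mxtrace_congr psumr_eq0 => [/allP h|i _]; last exact: spd_ge0.
apply/row_matrixP => i; rewrite row0; apply: trmx_inj; rewrite trmx0.
by apply: (spd_eq0 hQ); apply/eqP/h; rewrite mem_index_enum.
Qed.

(* A term with zero trace vanishes, so the junk value 0^-1 = 0 of its weight is
   harmless. *)
Lemma ellipsoid_trace_sum (I : finType) n d (B : I -> 'M[R]_(n, d))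
    (Q : I -> 'M[R]_d) (v : I -> 'cV[R]_d) (N : I -> 'M[R]_n) (P : 'M[R]_n) :
  (forall i, spd (Q i)) -> (forall i, ellipsoid 0 (Q i) (v i)) ->
  (forall i, N i = B i *m Q i *m (B i)^T) ->
  P = (\sum_i Num.sqrt (\tr (N i))) *: \sum_i (Num.sqrt (\tr (N i)))^-1 *: N i ->
  spd P -> ellipsoid 0 P (\sum_i B i *m v i).
Proof.
move=> hQ hv NE PE hP; apply: support_ellipsoid => // y.
rewrite {1}PE -scalemxAl dotvZr mulmx_suml !dotv_sumr.
under [X in _ <= _ * X]eq_bigr do rewrite -scalemxAl dotvZr.
apply: sqr_sum_le_weighted => i; first exact: sqrtr_ge0.
- by rewrite NE -!mulmxA !(dotv_mulmx (B i)) ellipsoid_support.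
- move/eqP; rewrite sqrtr_eq0 NE => tr0.
  have /(mxtrace_congr_eq0 (hQ i)) -> : \tr (B i *m Q i *m (B i)^T) = 0.
    by apply/eqP; rewrite eq_le tr0 mxtrace_congr_ge0.
  by rewrite !mul0mx /dotv mulmx0 mxE.
Qed.

End MinkowskiSum.

(** * Fusion of the measured and predicted ellipsoids *)

Section Fusion.
Context {R : realType}.
Variables (Pm Pf : 'M[R]_6) (q : R).
Hypotheses (hPm : spd Pm) (hPf : spd Pf) (q0 : 0 < q).

Let L := fuse_gain Pm Pf q.
(** The information matrix of the fused estimate: the inverse of the fused uncertainty matrix up to
    the scalar [fuse_beta]. *)
Let K := invmx Pm + q *: invmx Pf.

Lemma spd_fuse_sum : spd (Pm + q^-1 *: Pf).
Proof.
split=> [|x x0]; first by rewrite linearD linearZ /= hPm.1 hPf.1.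
rewrite mulmxDl dotvDr -scalemxAl dotvZr addr_gt0 ?mulr_gt0 ?invr_gt0 //.
- exact: hPm.2.
- exact: hPf.2.
Qed.

(** [K *m Pm] factors as [q *: invmx Pf *m (Pm + q^-1 *: Pf)], and the last factor cancels against
    the inverse in the gain. Thus [L *m c] is the center of the completed square. *)
Lemma information_fuse_gain : K *m L = q *: invmx Pf.
Proof.
rewrite /K /L /fuse_gain mulmxA mulmxDl mulVmx ?spd_unitmx //.
have -> : 1%:M + q *: invmx Pf *m Pm = q *: invmx Pf *m (Pm + q^-1 *: Pf).
  rewrite mulmxDr addrC -scalemxAr -(scalemxAl q _ Pf) mulVmx ?spd_unitmx //.
  by rewrite scalerA mulVf ?gt_eqF // scale1r.
by rewrite mulmxK // spd_unitmx //; exact: spd_fuse_sum.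
Qed.

Lemma invmx_fuse_covariance : invmx ((1%:M - L) *m Pm) = K.
Proof.
have KX : K *m ((1%:M - L) *m Pm) = 1%:M.
  rewrite mulmxA mulmxBr mulmx1 information_fuse_gain addrK.
  by rewrite mulVmx // spd_unitmx.
have [_ uX] := mulmx1_unit KX.
by rewrite -[RHS](mulmxK uX) KX mul1mx.
Qed.

(** Serves to express the quadratic term of [fuse_beta] through [Pf] alone, ready to cancel in the
    completed square. *)
Lemma fuse_gain_innovation : invmx Pm *m L = q *: invmx Pf - q *: (invmx Pf *m L).
Proof. by rewrite -information_fuse_gain /K mulmxDl -scalemxAl addrK. Qed.

Lemma ellipsoid_fuse (c z : 'cV[R]_6) :
  spd (fuse_uncertainty Pm Pf c q) ->
  ellipsoid 0 Pm z -> ellipsoid 0 Pf (z - c) ->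
  ellipsoid 0 (fuse_uncertainty Pm Pf c q) (z - L *m c).
Proof.
rewrite /ellipsoid /= !subr0 /fuse_uncertainty -/L; set b := fuse_beta _ _ _ _.
move=> hP zm zf; have hVm := spd_invmx hPm; have hVf := spd_invmx hPf.
(* Otherwise the fused matrix would be zero, hence singular. Together with
   [0 <= dotv d (K *m d) <= b] this makes [b] positive. *)
have bN0 : b != 0.
  apply/eqP => b0; have := spd_unitmx hP.
  by rewrite b0 scale0r unitmxE det0 unitr0.
set d := z - L *m c.
have KE u v : dotv u (K *m v)
    = dotv u (invmx Pm *m v) + q * dotv u (invmx Pf *m v).
  by rewrite /K mulmxDl dotvDr -scalemxAl dotvZr.
have dK : dotv d (K *m d) <= b.
  have KLc u : dotv u (K *m (L *m c)) = q * dotv u (invmx Pf *m c).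
    by rewrite mulmxA information_fuse_gain -scalemxAl dotvZr.
  have zKLc : dotv (L *m c) (K *m z) = q * dotv z (invmx Pf *m c).
    by rewrite KE !(spd_dotvC (L *m c) z) // -KE KLc.
  (* The term [q * dotv (L *m c) (invmx Pf *m c)] appears both here and in [dE]; once it cancels,
     the bound is [zm] plus [q] times [zf]. *)
  have bE : b = 1 + q - (q * dotv c (invmx Pf *m c)
      - q * dotv (L *m c) (invmx Pf *m c)).
    rewrite /b /fuse_beta -/L fuse_gain_innovation mulmxBl -!scalemxAl.
    by rewrite dotvDr dotvNr !dotvZr -(mulmxA _ L) [dotv c (_ *m (L *m c))]spd_dotvC.
  have dE : dotv d (K *m d) = dotv z (invmx Pm *m z) + q * dotv z (invmx Pf *m z)
      - 2 * q * dotv z (invmx Pf *m c) + q * dotv (L *m c) (invmx Pf *m c).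
    rewrite /d mulmxBr dotvDl dotvNl !dotvDr !dotvNr zKLc !KLc KE; ring.
  have := zf; rewrite mulmxBr dotvDl dotvNl !dotvDr !dotvNr.
  rewrite [dotv c (_ *m z)]spd_dotvC // dE bE => zf'.
  have := ler_wpM2l (ltW q0) zf'; lra.
have Kd0 : 0 <= dotv d (K *m d).
  by rewrite KE addr_ge0 ?mulr_ge0 ?spd_ge0 // ltW.
have b_gt0 : 0 < b by rewrite lt_neqAle eq_sym bN0 (le_trans Kd0).
have -> : invmx (b *: ((1%:M - L) *m Pm)) = b^-1 *: K.
  by rewrite -invmx_fuse_covariance; exact/invmxZ/spd_unitmx.
rewrite -scalemxAl dotvZr.
by rewrite mulrC ler_pdivrMr // mul1r.
Qed.

End Fusion.

(** * Rotations, error coordinates and the measurement error *)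

Section Attitude.
Context {R : realType}.

Lemma Smx_inj : injective (@Smx R).
Proof.
suff SmxK : cancel (@Smx R) (@vee R) by exact: can_inj SmxK.
move=> x; apply/colP => i; rewrite !mxE !eqxx !andbT.
have -> : i + 2%:R + 1 = i by apply/val_inj; case: i => [[|[|[|]]]].
have -> : i + 2%:R + 2%:R = i + 1 by apply/val_inj; case: i => [[|[|[|]]]].
have -> : (i == i + 1) = false by case: i => [[|[|[|]]]].
by rewrite eqxx mulr1 mulr0 subr0.
Qed.

Lemma SO3_mul (C F : 'M[R]_3) : SO3 C -> SO3 F -> SO3 (C *m F).
Proof.
move=> [C1 dC] [F1 dF]; split; last by rewrite det_mulmx dC dF mulr1.
by rewrite trmx_mul mulmxA -(mulmxA F^T) C1 mulmx1.
Qed.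

Lemma SO3_flow (J : 'M[R]_3) (h : R) (U : 'M[R]_3 -> R) (s : nat -> state R)
    (k l : nat) :
  (forall j, (k <= j < k + l)%N -> flow_step J h U (s j) (s j.+1)) ->
  SO3 (s k).1 -> SO3 (s (k + l)%N).1.
Proof.
move=> hs sk; elim: l hs => [|l IHl] hs; first by rewrite addn0.
have [|F [[F1 _] _ + _]] := hs (k + l)%N.
  by rewrite leq_addr addnS ltnSn.
rewrite addnS => ->; apply: SO3_mul F1; apply: IHl => j /andP[kj jl].
by apply: hs; rewrite kj addnS ltnW.
Qed.

Lemma att_vel_inj (x y : 'cV[R]_6) :
  att_part x = att_part y -> vel_part x = vel_part y -> x = y.
Proof.
rewrite /att_part /vel_part => xy1 xy2.
by rewrite -[x](@vsubmxK _ 3 3 1) -[y](@vsubmxK _ 3 3 1) xy1 xy2.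
Qed.

Lemma att_partD (x y : 'cV[R]_6) : att_part (x + y) = att_part x + att_part y.
Proof. exact: (@raddfD _ _ (@usubmx R 3 3 1)). Qed.

Lemma vel_partD (x y : 'cV[R]_6) : vel_part (x + y) = vel_part x + vel_part y.
Proof. exact: (@raddfD _ _ (@dsubmx R 3 3 1)). Qed.

(** The logarithm fixes the attitude part, since [Smx] is injective, and the state itself fixes the
    velocity part. This identifies the existential witness in [state_ellipsoid] with a given error
    vector. *)
Lemma error_coord_inj (sh s : state R) (x y : 'cV[R]_6) :
  error_coord sh s x -> error_coord sh s y -> x = y.
Proof.
move=> [sx lx] [sy ly]; apply: att_vel_inj.
  by apply: Smx_inj; rewrite lx ly.
by apply: (addrI sh.2); have := sy; rewrite sx => -[].
Qed.

Lemma H1_H2E (u v : 'cV[R]_3) :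
  H1 R *m u + H2 R *m v = (col_mx u v : 'cV[R]_(3 + 3)).
Proof.
rewrite /H1 /H2 (@mul_col_mx R 3 3 3 1) (@mul_col_mx R 3 3 3 1) !mul1mx !mul0mx.
by rewrite (@add_col_mx R 3 3 1) addr0 add0r.
Qed.

Lemma ellipsoid_meas m (A Sg : 'I_m -> 'M[R]_3) (T : 'M[R]_3)
    (nu : 'I_m -> 'cV[R]_3) (ups : 'cV[R]_3) (x : 'cV[R]_6) :
  (forall i, spd (Sg i)) -> spd T -> spd (meas_uncertainty A Sg T) ->
  (forall i, ellipsoid 0 (Sg i) (nu i)) -> ellipsoid 0 T ups ->
  att_part x = \sum_i A i *m nu i -> vel_part x = ups ->
  ellipsoid 0 (meas_uncertainty A Sg T) x.
Proof.
move=> hSg hT hP hnu hups xA xV.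
(* Each term of [meas_terms] is read as [B i *m Q i *m (B i)^T] with a definite 3 x 3 core [Q i], so
   that [x] becomes the sum of the images [B i *m v i]. *)
pose B i := if unlift ord_max i is Some j then H1 R *m A j else H2 R.
pose Q i := if unlift ord_max i is Some j then Sg j else T.
pose v i := if unlift ord_max i is Some j then nu j else ups.
have -> : x = \sum_i B i *m v i.
  rewrite (bigD1_ord ord_max) //= /B /v unlift_none.
  under eq_bigr do rewrite liftK -mulmxA.
  rewrite -mulmx_sumr -xA -xV addrC H1_H2E.
  by rewrite /att_part /vel_part (@vsubmxK _ 3 3 1).
apply: (@ellipsoid_trace_sum _ _ _ _ B Q v (meas_terms A Sg T)) => //.
- by move=> i; rewrite /Q; case: unliftP.
- by move=> i; rewrite /Q /v; case: unliftP.
- move=> i; rewrite /meas_terms /B /Q; case: unlift => //= j.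
  by rewrite trmx_mul !mulmxA.
Qed.

End Attitude.

(** * Assembly of the flow, measurement and fusion bounds *)

Theorem proposition3p1 (R : realType)
  (* dynamics *)
  (J : 'M[R]_3) (h : R) (U : 'M[R]_3 -> R)
  (hJ : spd J) (hh : 0 < h)
  (hU : forall C, SO3 C -> differentiable U C)
  (* actual trajectory s, predicted trajectory sf, time steps *)
  (k l : nat) (s sf : nat -> state R)
  (hs : forall j, (k <= j < k + l)%N -> flow_step J h U (s j) (s j.+1))
  (hsf : forall j, (k <= j < k + l)%N -> flow_step J h U (sf j) (sf j.+1))
  (hsfk : SO3 (sf k).1)
  (* flow update; the estimate at step k is sf k *)
  (Pk : 'M[R]_6) (A : nat -> 'M[R]_6) (Af Pf : 'M[R]_6)
  (hPk : spd Pk)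
  (hA : forall j, (k <= j < k + l)%N ->
          flow_linearization J h U (sf j) (sf j.+1) (A j))
  (hAf : Af = flow_matrix A k l)
  (hPf : Pf = Af *m Pk *m Af^T) (hPf_spd : spd Pf)
  (* measurements *)
  (m : nat) (hm : (3 <= m)%N)
  (e b bt : 'I_m -> 'cV[R]_3) (nu : 'I_m -> 'cV[R]_3)
  (wt ups : 'cV[R]_3) (Sg : 'I_m -> 'M[R]_3) (T : 'M[R]_3)
  (he : forall i, unit_vector (e i))
  (he_ncol : forall i j, i != j -> free [:: e i; e j])
  (hb : forall i, unit_vector (b i))
  (heb : forall i, e i = (s (k + l)%N).1 *m b i)
  (hbt : forall i, unit_vector (bt i))
  (hnu : forall i, b i = expm (Smx (nu i)) *m bt i)
  (hups : (s (k + l)%N).2 = wt + ups)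
  (hSg : forall i, spd (Sg i)) (hT : spd T)
  (* measurement update *)
  (w : 'I_m -> R) (Lt Qq Qr Cm : 'M[R]_3) (wm : 'cV[R]_3)
  (Am : 'I_m -> 'M[R]_3) (Pm : 'M[R]_6)
  (hLt : Lt = Lmat e bt w) (hLt_unit : Lt \in unitmx)
  (hQR : Lt = Qq *m Qr) (hQq : SO3 Qq)
  (hQr : is_trig_mx Qr^T) (hQr_unit : Qr \in unitmx)
  (hCm : Cm = meas_attitude Qq Qr Lt) (hwm : wm = wt)
  (hAm : forall i, Am i = meas_gain e bt w Lt Cm i)
  (hPm : Pm = meas_uncertainty Am Sg T) (hPm_spd : spd Pm)
  (* the predicted state relative to the measured one *)
  (xmf : 'cV[R]_6) (hxmf : sf (k + l)%N = perturb (Cm, wm) xmf)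
  (* estimate; q minimizes the trace of the uncertainty matrix *)
  (q : R) (L P : 'M[R]_6) (xh : 'cV[R]_6) (Ch : 'M[R]_3) (wh : 'cV[R]_3)
  (hq : 0 < q)
  (hq_min : forall q' : R, 0 < q' ->
     \tr (fuse_uncertainty Pm Pf xmf q) <= \tr (fuse_uncertainty Pm Pf xmf q'))
  (hL : L = fuse_gain Pm Pf q) (hxh : xh = L *m xmf)
  (hP : P = fuse_uncertainty Pm Pf xmf q) (hP_spd : spd P)
  (hCh : Ch = Cm *m expm (Smx (att_part xh)))
  (hwh : wh = wm + vel_part xh)
  (* errors of the actual state relative to the four centers *)
  (xk xf xm x : 'cV[R]_6)
  (hxk : error_coord (sf k) (s k) xk)
  (hxf : s (k + l)%N = perturb (sf (k + l)%N) xf)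
  (hxm : s (k + l)%N = perturb (Cm, wm) xm)
  (hx : error_coord (Ch, wh) (s (k + l)%N) x)
  (* first-order relations, taken as exact *)
  (fo_flow : xf = Af *m xk)
  (fo_meas : att_part xm = \sum_(i < m) Am i *m nu i)
  (fo_mf : att_part xm = att_part xmf + att_part xf)
  (fo_est : att_part xm = att_part xh + att_part x)
  (* error bounds *)
  (hk_in : state_ellipsoid (sf k) Pk (s k))
  (hnu_in : forall i, ellipsoid 0 (Sg i) (nu i))
  (hups_in : ellipsoid 0 T ups) :
  state_ellipsoid (Ch, wh) P (s (k + l)%N).
Proof.
split; first by apply: SO3_flow hs _; exact: hk_in.1.
exists x => //=.
have xkE : ellipsoid 0 Pk xk.
  by have [_ [y yP /(error_coord_inj hxk) ->]] := hk_in.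
have xfE : ellipsoid 0 Pf xf.
  by rewrite fo_flow hPf; apply: ellipsoid_mulmx; rewrite -?hPf.
(* Velocity errors add exactly, as two expressions of the same velocity are compared; only the
   attitude relations are first-order assumptions. *)
have vel_mf : vel_part xm = vel_part xmf + vel_part xf.
  by apply: (addrI wm); have := hxf; rewrite hxm hxmf addrA => -[].
have vel_est : vel_part xm = vel_part xh + vel_part x.
  by apply: (addrI wm); have := hx.1; rewrite hxm hwh addrA => -[].
have vel_ups : vel_part xm = ups.
  by apply: (addrI wt); rewrite -hups hxm hwm.
have xmE : ellipsoid 0 Pm xm.
  by rewrite hPm; apply: ellipsoid_meas fo_meas vel_ups; rewrite -?hPm.
have xm_mf : xm = xmf + xf.
  by apply: att_vel_inj; rewrite ?att_partD ?vel_partD.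
have xm_est : xm = xh + x.
  by apply: att_vel_inj; rewrite ?att_partD ?vel_partD.
(* The fusion bound applies with [z = xm] and [c = xmf], for which [z - c] is the flow error
   [xf]. *)
have -> : x = xm - L *m xmf by rewrite xm_est -hxh addrC addKr.
rewrite hP hL; apply: ellipsoid_fuse => //; first by rewrite -hP.
by rewrite xm_mf addrC addKr.
Qed.
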